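(* Let $n,k\ge 0$ be integers with $n\ge 2k$, and let $\Pi_{n,k}=\{w\in S_n : w_1<w_2<\cdots<w_{n-k},\ \operatorname{is}(w)=n-k\}$. Then $$\sum_{w\in\Pi_{n,k}}q^{\operatorname{maj}(w^{-1})}=\sum_{r=0}^{k}(-1)^{k-r}\binom{k}{r}[n]_q[n-1]_q\cdots[n-r+1]_q,$$ where the product for $r=0$ is $1$.
   Context: Permutations $w\in S_n$ are written in one-line notation $w=w_1w_2\cdots w_n$. $\operatorname{is}(w)$ denotes the maximal length of an increasing subsequence of $w$. $\operatorname{maj}(\sigma)=\sum_{i:\,\sigma_i>\sigma_{i+1}}i$ is the major index of $\sigma$, $w^{-1}$ is the inverse permutation, and $[m]_q=\frac{1-q^m}{1-q}$. The binomial coefficient $\binom{k}{r}$ is the ordinary one. *)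

(* Defs.v *)
From HB Require Import structures.
From mathcomp Require Import all_boot all_order all_algebra all_fingroup.

Set Implicit Arguments.
Unset Strict Implicit.
Unset Printing Implicit Defensive.

Import GRing.Theory.

(* A permutation w = w_1 w_2 ... w_n of {1, ..., n} is represented by w : 'S_n,
   a permutation of {0, ..., n-1}: positions and values are both shifted down
   by one, so that w_(i+1) - 1 is w i. *)

(* A subsequence is represented by the set of positions it occupies. *)
Definition increasing_on n (w : 'S_n) (A : {set 'I_n}) : bool :=
  [forall i in A, forall j in A, (i < j)%N ==> (w i < w j)%N].

Definition lis n (w : 'S_n) : nat :=
  \max_(A : {set 'I_n} | increasing_on w A) #|A|.

(* The 0-based positions i, i+1 are the 1-based positions i+1, i+2, hence a
   descent there contributes i+1. *)
Definition maj n (s : 'S_n) : nat :=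
  \sum_(i < n) \sum_(j < n | (j == i.+1 :> nat) && (s j < s i)%N) i.+1.

Definition PiSet (n k : nat) : {set 'S_n} :=
  [set w : 'S_n |
     [forall i : 'I_n, forall j : 'I_n,
        ((i < j)%N && (j < n - k)%N) ==> (w i < w j)%N]
     && (lis w == (n - k)%N)].

Local Open Scope ring_scope.

(* The indeterminate q, in the field of rational functions Frac(Z[q]) = Q(q). *)
Definition q : {fraction {poly int}} := tofrac 'X.

Definition qint (m : nat) : {fraction {poly int}} := (1 - q ^+ m) / (1 - q).

(* Main.v *)
(* Words are inserted letter by letter into the first row of the Schensted
   algorithm: a word w goes to the final row R, the stack u of bumped letters and
   the bits T telling which insertions bumped.  By Schensted is(w) = |R|; the
   first n - s letters of w increase iff the first n - s bits are false; and w is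
   Knuth equivalent to the bumped letters followed by R, so the descent set of
   w^-1 depends on (R, u) only.  If n >= 2s, the pairs (R, u) that occur together
   with given bits, the first n - s of which are false, depend only on the number
   a of true bits.  Writing Y_a for the left-hand side with k = a, this gives
     sum_{w_1 < ... < w_{n-s}} q^maj(w^-1) = sum_a binom(s, a) Y_a,
   while Carlitz' insertion of a new maximum into w^-1 evaluates the left side to
   [n]_q [n-1]_q ... [n-s+1]_q.  Binomial inversion concludes. *)

Require Import Defs.
From mathcomp Require Import all_boot all_order all_algebra all_fingroup.
From mathcomp Require Import zify ring.

Set Implicit Arguments.
Unset Strict Implicit.
Unset Printing Implicit Defensive.

(** * Strictly increasing rows and the insertion position [find (leq x) R] *)

Lemma nth_sorted_ltn (R : seq nat) i j :
  sorted ltn R -> i < j -> j < size R -> nth 0 R i < nth 0 R j.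
Proof.
move=> sR ij jR; apply: (sorted_ltn_nth ltn_trans) => //.
by rewrite inE (ltn_trans ij).
Qed.

Lemma nth_sorted_leq (R : seq nat) i j :
  sorted ltn R -> i <= j -> j < size R -> nth 0 R i <= nth 0 R j.
Proof.
by move=> sR; rewrite leq_eqVlt => /predU1P[-> //|ij jR]; exact/ltnW/nth_sorted_ltn.
Qed.

Lemma nth_lt_find (R : seq nat) x i : i < find (leq x) R -> nth 0 R i < x.
Proof. by move/(before_find 0)/negbT; rewrite -ltnNge. Qed.

Lemma nth_ge_find (R : seq nat) x i : sorted ltn R ->
  find (leq x) R <= i -> i < size R -> x <= nth 0 R i.
Proof.
move=> sR pi iR; apply: leq_trans (nth_sorted_leq sR pi iR).
by apply: (nth_find 0); rewrite has_find (leq_ltn_trans pi).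
Qed.

Lemma nth_gt_find (R : seq nat) x i : sorted ltn R -> x \notin R ->
  find (leq x) R <= i -> i < size R -> x < nth 0 R i.
Proof.
move=> sR xR pi iR; rewrite ltn_neqAle nth_ge_find // andbT.
by apply: contraNneq xR => ->; rewrite mem_nth.
Qed.

Lemma find_leq_eq (R : seq nat) x p : p <= size R ->
  (forall i, i < p -> nth 0 R i < x) -> (p < size R -> x <= nth 0 R p) ->
  find (leq x) R = p.
Proof.
move=> pR lt_x ge_x; apply/eqP; rewrite eqn_leq; apply/andP; split.
  rewrite leqNgt; apply/negP => pf.
  have pR' : p < size R by apply: leq_trans pf (find_size _ _).
  by have:= nth_lt_find pf; rewrite ltnNge ge_x.
rewrite leqNgt; apply/negP => fp.
have hasx : has (leq x) R by rewrite has_find (leq_trans fp).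
by have:= nth_find 0 hasx; rewrite leqNgt lt_x.
Qed.

Lemma size_set_nth_le (R : seq nat) p x : p < size R -> size (set_nth 0 R p x) = size R.
Proof. by move=> pR; rewrite size_set_nth; apply/maxn_idPr. Qed.

Lemma sorted_set_nth (R : seq nat) p x : sorted ltn R -> p <= size R ->
  (forall i, i < p -> nth 0 R i < x) ->
  (forall i, p < i -> i < size R -> x < nth 0 R i) ->
  sorted ltn (set_nth 0 R p x).
Proof.
move=> sR pR lt_x gt_x; apply/(sortedP 0) => i.
rewrite size_set_nth !nth_set_nth /= => iR.
case: (eqVneq i.+1 p) => [ip|ip].
  by rewrite ifN; [apply: lt_x; lia | lia].
case: (eqVneq i p) => [ip'|ip']; first by apply: gt_x; lia.
by apply: nth_sorted_ltn => //; lia.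
Qed.

Lemma perm_set_nth (R : seq nat) p x : p < size R ->
  perm_eq (nth 0 R p :: set_nth 0 R p x) (x :: R).
Proof.
move=> pR; rewrite set_nthE pR -[in X in perm_eq _ X](cat_take_drop p R) (drop_nth 0 pR).
by apply/seq.permP => a; rewrite /= !count_cat /=; lia.
Qed.

Lemma set_nthK (R : seq nat) p x : p < size R ->
  set_nth 0 (set_nth 0 R p x) p (nth 0 R p) = R.
Proof.
move=> pR; apply: (@eq_from_nth _ 0) => [|i _]; first by rewrite !size_set_nth; lia.
by rewrite nth_set_nth /=; case: eqP => [-> //|/eqP/negPf ip]; rewrite nth_set_nth /= ip.
Qed.

Lemma set_nth_size (R : seq nat) x : set_nth 0 R (size R) x = rcons R x.
Proof. by rewrite set_nthE ltnn subnn cats1. Qed.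

(** * Row insertion and its inverse *)

(* [u] and [T] are stacks: the head is the most recent bump or bit. *)
Definition insert_step (st : seq nat * seq nat * bitseq) (x : nat) :=
  let: (R, u, T) := st in
  let p := find (leq x) R in
  (set_nth 0 R p x, if p < size R then nth 0 R p :: u else u, (p < size R) :: T).

Definition insert_word (w : seq nat) : seq nat * seq nat * bitseq :=
  foldl insert_step ([::], [::], [::]) w.

(** Reverse row insertion: the last bumped letter [z] takes the place of the greatest entry below
    it, which is the letter that had bumped [z]. Without a bump, the inserted letter is the end of
    the row. *)
Definition extract_step (b : bool) (R u : seq nat) : nat * seq nat * seq nat :=
  if b then
    let z := head 0 u in let p := (find (leq z) R).-1 in
    (nth 0 R p, set_nth 0 R p z, behead u)
  else (last 0 R, take (size R).-1 R, u).

Fixpoint extract_word (T : bitseq) (R u : seq nat) : seq nat :=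
  if T is b :: T' then
    let: (y, R', u') := extract_step b R u in rcons (extract_word T' R' u') y
  else [::].

Definition extractible (b : bool) (R u : seq nat) : bool :=
  if b then (u != [::]) && (0 < find (leq (head 0 u)) R) else R != [::].

Fixpoint all_extractible (T : bitseq) (R u : seq nat) : bool :=
  if T is b :: T' then
    extractible b R u &&
    (let: (_, R', u') := extract_step b R u in all_extractible T' R' u')
  else (R == [::]) && (u == [::]).

Lemma insert_stepK (R u : seq nat) (T : bitseq) x : sorted ltn R -> x \notin R ->
  exists R' u' b, [/\ insert_step (R, u, T) x = (R', u', b :: T),
    sorted ltn R', perm_eq (R' ++ u') (x :: R ++ u), extractible b R' u' &
    extract_step b R' u' = (x, R, u)].
Proof.
move=> sR xR; rewrite /insert_step; set p := find _ _.
have pR : p <= size R by apply: find_size.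
have sR' : sorted ltn (set_nth 0 R p x).
  apply: sorted_set_nth => // i; first exact: nth_lt_find.
  by move=> /ltnW; exact: nth_gt_find.
exists (set_nth 0 R p x), (if p < size R then nth 0 R p :: u else u), (p < size R).
case: (ltnP p (size R)) => pR'.
  (* After the bump, exactly the entries up to position [p] lie below the bumped letter, so reverse
     insertion returns to [p]. *)
  have fE : find (leq (nth 0 R p)) (set_nth 0 R p x) = p.+1.
    have xp : x < nth 0 R p by apply: nth_gt_find.
    apply: find_leq_eq; first by rewrite size_set_nth_le.
      move=> i ip; rewrite nth_set_nth /=; case: eqP => [//|ip'].
      by apply: nth_sorted_ltn => //; lia.
    rewrite size_set_nth_le // => p1; rewrite nth_set_nth /= ifN; last by lia.
    by apply/ltnW/nth_sorted_ltn.
  split=> //.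
  - have /seq.permP eqc := perm_set_nth x pR'.
    by apply/seq.permP => a; move: (eqc a); rewrite /= !count_cat /=; lia.
  - by rewrite /extractible /= fE.
  - rewrite /extract_step /= fE /= nth_set_nth /= eqxx; congr (_, _, _).
    exact: set_nthK.
have pE : p = size R by apply/eqP; rewrite eqn_leq pR.
rewrite pE set_nth_size in sR' *; split=> //.
- by rewrite -cats1 -catA perm_catCA.
- by rewrite /extractible -size_eq0 size_rcons.
- by rewrite /extract_step last_rcons size_rcons /= -cats1 take_size_cat.
Qed.

(** The letter [z] put back replaces some [y < z], and the entries before it are below [y]; hence
    inserting [y] again stops at [z] and bumps it. *)
Lemma extract_stepK (R u : seq nat) (T : bitseq) b : sorted ltn R ->
  uniq (R ++ u) -> extractible b R u ->
  exists y R' u', [/\ extract_step b R u = (y, R', u'), sorted ltn R',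
    perm_eq (y :: R' ++ u') (R ++ u) & insert_step (R', u', T) y = (R, u, b :: T)].
Proof.
move=> sR uR; case: b => /=; last first.
  case/lastP: R sR uR => [//|R y] sR uR _; exists y, R, u; split.
  - by rewrite /extract_step last_rcons size_rcons /= -cats1 take_size_cat.
  - by apply: subseq_sorted sR; [exact: ltn_trans | exact: subseq_rcons].
  - by rewrite -cats1 -catA perm_sym perm_catCA.
  have fE : find (leq y) R = size R.
    apply: find_leq_eq => // [i iR|]; last by rewrite ltnn.
    have := @nth_sorted_ltn _ i (size R) sR iR.
    by rewrite size_rcons !nth_rcons iR ltnn eqxx; apply.
  by rewrite /insert_step fE ltnn set_nth_size.
case: u uR => [//|z u] uR /= fz; set p := (find _ _).-1.
have zR : z \notin R.
  move: uR; rewrite cat_uniq => /and3P[_ /hasPn/(_ z)].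
  by rewrite mem_head => /(_ isT).
have pR : p < size R by have := find_size (leq z) R; rewrite /p; lia.
have pE : find (leq z) R = p.+1 by rewrite /p; lia.
have yz : nth 0 R p < z by apply: nth_lt_find; rewrite pE.
exists (nth 0 R p), (set_nth 0 R p z), u; split=> //.
- apply: sorted_set_nth => // [|i ip|i ip iR]; first exact: ltnW.
    by apply: nth_lt_find; rewrite pE; lia.
  by apply: nth_gt_find => //; rewrite pE.
- rewrite -cat_cons (perm_trans (y := (z :: R) ++ u)) ?perm_cat2r ?perm_set_nth //.
  by apply/seq.permP => a; rewrite /= !count_cat /=; lia.
have fE : find (leq (nth 0 R p)) (set_nth 0 R p z) = p.
  apply: find_leq_eq; first by rewrite size_set_nth_le // ltnW.
    by move=> i ip; rewrite nth_set_nth /= ifN; [exact: nth_sorted_ltn | lia].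
  by move=> _; rewrite nth_set_nth /= eqxx ltnW.
rewrite /insert_step fE size_set_nth_le // pR nth_set_nth /= eqxx.
congr (_, _, _); exact: set_nthK.
Qed.

Lemma insert_word_rcons (w : seq nat) (x : nat) :
  insert_word (rcons w x) = insert_step (insert_word w) x.
Proof. exact: foldl_rcons. Qed.

Lemma size_bumped (w R u : seq nat) (T : bitseq) : insert_word w = (R, u, T) ->
  size T = size w /\ size u = count id T.
Proof.
elim/last_ind: w R u T => [|w x IHw] R u T; first by move=> [_ <- <-].
rewrite insert_word_rcons size_rcons.
case: (insert_word w) IHw => [[R0 u0] T0] /(_ _ _ _ erefl)[<- uT0].
by move=> [_ <- <-] /=; case: ifP => _ /=; rewrite uT0.
Qed.

(** Insertions are undone from the last to the first; row, stack and bits thus determine the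
    word. *)
Lemma insert_wordK (w R u : seq nat) (T : bitseq) : uniq w -> insert_word w = (R, u, T) ->
  [/\ sorted ltn R, perm_eq (R ++ u) w, all_extractible T R u & extract_word T R u = w].
Proof.
elim/last_ind: w R u T => [|w x IHw] R u T; first by move=> _ [<- <- <-].
rewrite insert_word_rcons rcons_uniq => /andP[xw uw].
case: (insert_word w) IHw => [[R0 u0] T0] /(_ _ _ _ uw erefl)[sR0 pw ok0 eq0].
have xR0 : x \notin R0.
  by apply: contra xw => xR; rewrite -(perm_mem pw) mem_cat xR.
have [R' [u' [b [-> sR' pR' okb extb]]]] := insert_stepK u0 T0 sR0 xR0.
case=> <- <- <-; split=> //=; last 2 first.
- by rewrite okb extb.
- by rewrite extb eq0.
rewrite (perm_trans pR') // perm_sym perm_rcons perm_cons perm_sym //.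
Qed.

(** Surjectivity: with the bits fixed, the pairs [(R, u)] that occur are those passing the test
    [all_extractible]. *)
Lemma extract_wordK (T : bitseq) (R u : seq nat) :
  sorted ltn R -> uniq (R ++ u) -> all_extractible T R u ->
  perm_eq (extract_word T R u) (R ++ u) /\ insert_word (extract_word T R u) = (R, u, T).
Proof.
elim: T R u => [|b T IHT] R u sR uR /=; first by case/andP=> /eqP-> /eqP->.
case/andP=> okb.
have [y [R' [u' [-> sR' pR' ins]]]] := extract_stepK T sR uR okb.
have : uniq (y :: R' ++ u') by rewrite (perm_uniq pR').
case/andP=> _ uR' /(IHT _ _ sR' uR')[pw insT]; split.
  by rewrite perm_rcons -(permPr pR') perm_cons.
by rewrite insert_word_rcons insT ins.
Qed.

(** * Relative order of consecutive values *)

(* Knuth relations never exchange two consecutive values. *)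
Lemma filter_insert_word (w R u : seq nat) (T : bitseq) (v : nat) :
  uniq w -> insert_word w = (R, u, T) ->
  filter (pred2 v v.+1) w = filter (pred2 v v.+1) (rev u ++ R).
Proof.
elim/last_ind: w R u T => [|w x IHw] R u T; first by move=> _ [<- <- _].
rewrite insert_word_rcons rcons_uniq => /andP[xw uw].
case E : (insert_word w) => [[R0 u0] T0].
have [sR0 pw _ _] := insert_wordK uw E.
have xR0 : x \notin R0.
  by apply: contra xw => xR; rewrite -(perm_mem pw) mem_cat xR.
rewrite filter_rcons (IHw _ _ _ uw E) /insert_step.
set p := find _ _; have pR0 : p <= size R0 by apply: find_size.
case: ltnP => pR [<- <- _]; last first.
  have pE : p = size R0 by apply/eqP; rewrite eqn_leq pR0.
  by rewrite pE set_nth_size -rcons_cat filter_rcons.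
set z := nth 0 R0 p; have xz : x < z by apply: nth_gt_find.
rewrite set_nthE pR rev_cons -!cats1.
have R0E : R0 = take p R0 ++ z :: drop p.+1 R0.
  by rewrite -[LHS](cat_take_drop p) (drop_nth 0 pR).
(* The letters [A z B x] become [z A x B]. Here [z] passes only letters below [x < z], and [x] only
   letters above [z > x]; these differ from the moving letter by at least 2. *)
rewrite [in LHS]R0E; set A := take p R0; set B := drop p.+1 R0.
have ltA r : r \in A -> r < x.
  case/(nthP 0) => i; rewrite size_take_min leq_min => /andP[ip _] <-.
  by rewrite nth_take //; apply: nth_lt_find.
have gtB r : r \in B -> z < r.
  case/(nthP 0) => i; rewrite size_drop => ip <-.
  by rewrite nth_drop; apply: nth_sorted_ltn; rewrite -?ltn_subRL //; apply: leq_addr.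
have PA : pred2 v v.+1 z -> filter (pred2 v v.+1) A = [::].
  move=> /= vz; apply/eqP; rewrite -[_ == _]negbK -has_filter; apply/hasPn => r /ltA /=.
  by lia.
have PB : pred2 v v.+1 x -> filter (pred2 v v.+1) B = [::].
  move=> /= vx; apply/eqP; rewrite -[_ == _]negbK -has_filter; apply/hasPn => r /gtB /=.
  by lia.
move: (pred2 v v.+1) PA PB => P PA PB.
rewrite -catA !filter_cat /= -catA; case: (boolP (P z)) => [/PA->|Pz].
  by case: (boolP (P x)) => [/PB->|Px]; rewrite ?cats0.
by case: (boolP (P x)) => [/PB->|Px]; rewrite ?cats0.
Qed.

(** * Bits and increasing prefixes *)

Lemma all_ltn_find (R : seq nat) x : x \notin R ->
  (find (leq x) R < size R) = ~~ all (gtn x) R.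
Proof.
move=> xR; rewrite -has_find -has_predC; apply: eq_in_has => r rR /=.
by rewrite -leqNgt.
Qed.

Lemma sorted_ltn_rcons (w : seq nat) x :
  sorted ltn (rcons w x) = all (gtn x) w && sorted ltn w.
Proof. by rewrite !(sorted_pairwise ltn_trans) pairwise_rcons. Qed.

Lemma insert_word_sorted (w : seq nat) : uniq w -> sorted ltn w ->
  insert_word w = (w, [::], nseq (size w) false).
Proof.
elim/last_ind: w => [//|w x IHw]; rewrite rcons_uniq sorted_ltn_rcons size_rcons.
case/andP=> xw uw /andP[wx sw]; rewrite insert_word_rcons IHw // /insert_step.
rewrite all_ltn_find // wx /= -/(nseq _.+1 false); congr (_, _, _).
rewrite -set_nth_size; congr set_nth; apply/eqP; rewrite eqn_leq find_size.
by rewrite leqNgt all_ltn_find // wx.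
Qed.

(** A letter that bumps nothing exceeds the whole row, and while nothing has been bumped the row is
    the word read so far. *)
Lemma sorted_insert_word (w : seq nat) : uniq w ->
  (insert_word w).2 = nseq (size w) false -> sorted ltn w.
Proof.
elim/last_ind: w => [//|w x IHw]; rewrite rcons_uniq sorted_ltn_rcons size_rcons.
case/andP=> xw uw; rewrite insert_word_rcons.
case E : (insert_word w) => [[R u] T]; rewrite /insert_step /= => -[Rx TE].
have sw : sorted ltn w by apply: IHw => //; rewrite E.
move: E; rewrite insert_word_sorted // => -[RE _ _]; subst R.
by move: Rx; rewrite sw all_ltn_find // andbT => /negbFE.
Qed.

Lemma insert_cat_bits st (w : seq nat) :
  exists2 T, size T = size w & (foldl insert_step st w).2 = T ++ st.2.
Proof.
elim/last_ind: w => [|w x [T sT IHw]]; first by exists [::].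
rewrite foldl_rcons; case: (foldl _ _ _) IHw => [[R u] T0] /= ->.
by eexists (_ :: T); rewrite ?size_rcons /= ?sT.
Qed.

(** Bits are stacked, so those of the first [m] letters are the last [m] of the list. *)
Lemma insert_bits_take (w : seq nat) m : uniq w -> m <= size w ->
  (drop (size w - m) (insert_word w).2 == nseq m false) = sorted ltn (take m w).
Proof.
move=> uw mw; have [T sT TE] := insert_cat_bits (insert_word (take m w)) (drop m w).
have sm : size (take m w) = m by apply: size_takel.
have -> : (insert_word w).2 = T ++ (insert_word (take m w)).2.
  by rewrite -TE -foldl_cat cat_take_drop.
rewrite drop_size_cat ?sT ?size_drop // -{2}sm.
have um := take_uniq m uw; apply/eqP/idP => [|st].
  exact: sorted_insert_word.
by rewrite insert_word_sorted.
Qed.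

(** * Independence from the order of the bits *)

(* The case of [all_extractible] where all bumps occurred last. *)
Fixpoint all_unbump (u R : seq nat) : bool :=
  if u is z :: u' then
    let p := find (leq z) R in (0 < p) && all_unbump u' (set_nth 0 R p.-1 z)
  else true.

(** If the first [c.+1] entries contain one that is at least [z], both rows change at the same
    place; otherwise both change at index [c] or later, which a prefix of length [c] does not
    see. *)
Lemma take_unbump c (R R1 : seq nat) z :
  let p := find (leq z) R in let p1 := find (leq z) R1 in
  c.+1 <= size R -> c.+1 <= size R1 -> take c.+1 R = take c.+1 R1 ->
  (0 < p) = (0 < p1) /\
  (0 < p -> take c (set_nth 0 R p.-1 z) = take c (set_nth 0 R1 p1.-1 z)).
Proof.
move=> p p1 cR cR1 eqt.
have nthE i : i <= c -> nth 0 R i = nth 0 R1 i.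
  by move=> ic; rewrite -(nth_take 0 (n0 := c.+1)) // eqt nth_take.
have pR : p <= size R := find_size _ _.
have pR1 : p1 <= size R1 := find_size _ _.
have minE : minn p c.+1 = minn p1 c.+1.
  have E (S : seq nat) : c.+1 <= size S ->
      find (leq z) (take c.+1 S) = minn (find (leq z) S) c.+1.
    move=> cS; case: (boolP (has (leq z) (take c.+1 S))) => h.
      have := h; rewrite has_take_leq // => fS.
      rewrite -[X in minn (find _ X) _](cat_take_drop c.+1) find_cat h.
      by apply/esym/minn_idPl; move: h; rewrite has_find size_takel // => /ltnW.
    rewrite hasNfind // size_takel //; apply/esym/minn_idPr.
    by move: h; rewrite has_take_leq // -leqNgt.
  by rewrite -!E // eqt.
split=> [|p_gt0]; first by lia.
apply: (@eq_from_nth _ 0); first by rewrite !size_take_min !size_set_nth; lia.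
move=> i; rewrite size_take_min leq_min => /andP[ic _]; rewrite !nth_take // !nth_set_nth /=.
rewrite nthE ?(ltnW ic) //; congr (if _ then _ else _); lia.
Qed.

(* With [m >= size u], removing the maximum of the row never affects the entries
   that later extractions depend on; this is where [n >= 2k] is used. *)
Lemma all_extractible_unbump m (T : bitseq) (R R1 u : seq nat) :
  size u = count id T -> size R + size u = m + size T -> size u <= m ->
  size u <= size R1 -> take (size u) R = take (size u) R1 ->
  all_extractible (T ++ nseq m false) R u = all_unbump u R1.
Proof.
elim: T R R1 u => [|b T IHT] R R1 u.
  move=> /size0nil -> /=; rewrite !addn0 => + _ _ _.
  elim: m R => [|m IHm] R Rm; first by rewrite (size0nil Rm).
  rewrite /= /extractible -size_eq0 Rm /=; apply: IHm.
  by rewrite size_take_min Rm /=; lia.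
have Tu : count id T <= size T := count_size _ _.
case: b => /=.
  case: u => [//|z u] /= [uT] sR um uR1 eqt; rewrite /extractible /=.
  have cR : (size u).+1 <= size R by lia.
  have [<- tE] := take_unbump z cR uR1 eqt; case: (boolP (0 < find (leq z) R)) => //= p0.
  have pR := find_size (leq z) R.
  apply: IHT; rewrite ?size_set_nth ?tE //; lia.
(* The row has more than [m >= size u] entries, so removing its last one keeps the first
   [size u]. *)
rewrite add0n => uT sR um uR1 eqt.
rewrite /extractible -size_eq0; have -> /= : size R != 0 by lia.
apply: IHT; rewrite ?size_take_min //; first by lia.
by rewrite take_takel //; lia.
Qed.

(** * Schensted's theorem on increasing subsequences *)

Lemma subseq_rcons_rcons (t w : seq nat) y x :
  subseq (rcons t y) (rcons w x) -> subseq (rcons t y) w \/ y = x /\ subseq t w.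
Proof.
rewrite -subseq_rev !rev_rcons /=; have [->|_] := eqVneq y x.
  by rewrite subseq_rev; right.
by rewrite -rev_rcons subseq_rev; left.
Qed.

(** Schensted's invariant: entry [i] of the row is the smallest possible end of an increasing
    subsequence of length [i.+1]. *)
Lemma insert_word_subseq (w R u : seq nat) (T : bitseq) :
  uniq w -> insert_word w = (R, u, T) ->
  (forall i, i < size R -> exists2 t, size t = i &
     subseq (rcons t (nth 0 R i)) w && sorted ltn (rcons t (nth 0 R i))) /\
  (forall t x, subseq (rcons t x) w -> sorted ltn (rcons t x) ->
     size t < size R /\ nth 0 R (size t) <= x).
Proof.
elim/last_ind: w R u T => [|w x IHw] R u T.
  move=> _ [<- _ _]; split=> // t x; rewrite subseq0 -size_eq0 size_rcons //.
rewrite insert_word_rcons rcons_uniq => /andP[xw uw].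
case E : (insert_word w) => [[R0 u0] T0].
have [sR0 pw _ _] := insert_wordK uw E.
have xR0 : x \notin R0.
  by apply: contra xw => xR; rewrite -(perm_mem pw) mem_cat xR.
have [IHex IHle] := IHw _ _ _ uw E.
rewrite /insert_step; set p := find _ _ => -[<- _ _].
have pR0 : p <= size R0 by apply: find_size.
have wwx : subseq w (rcons w x) := subseq_rcons _ _.
split=> [i|t y].
  rewrite size_set_nth nth_set_nth /=; case: (eqVneq i p) => [-> _|ip iR]; last first.
    have iR' : i < size R0 by lia.
    have [t st /andP[tw tR]] := IHex i iR'.
    by exists t; rewrite // (subseq_trans tw wwx).
  (* The new entry [x] extends a subsequence that ends in its left neighbour. *)
  case pE : p => [|p']; first by exists [::]; rewrite // sub1seq mem_rcons mem_head.
  have pR' : p' < size R0 by rewrite -pE.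
  have [t st /andP[tw tR]] := IHex p' pR'.
  exists (rcons t (nth 0 R0 p')); first by rewrite size_rcons st.
  rewrite sorted_ltn_rcons tR andbT -(subseq_rev (rcons _ x)) !rev_rcons /= eqxx.
  rewrite -rev_rcons subseq_rev tw /= all_rcons /=.
  have xp : nth 0 R0 p' < x by apply: nth_lt_find; rewrite -/p pE.
  rewrite xp /=; apply/allP => r rt /=; apply: ltn_trans xp.
  by move: tR; rewrite sorted_ltn_rcons => /andP[/allP/(_ r rt)].
have leR i : i < size R0 -> nth 0 (set_nth 0 R0 p x) i <= nth 0 R0 i.
  by rewrite nth_set_nth /=; case: eqP => // -> pR; apply: nth_ge_find.
have sR : sorted ltn (set_nth 0 R0 p x).
  apply: sorted_set_nth => // i; first exact: nth_lt_find.
  by move=> /ltnW; exact: nth_gt_find.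
move=> /subseq_rcons_rcons[tw|[-> tw]] st.
  have [tR ty] := IHle t y tw st; rewrite size_set_nth; split; first by lia.
  exact: leq_trans (leR _ tR) ty.
(* The letter before [x] in the subsequence is below [x] and bounds the row entry at its index, so
   this index is less than [p]. *)
have tp : size t <= p.
  case/lastP: t tw st => [//|t z] tw.
  rewrite sorted_ltn_rcons all_rcons => /andP[/andP[/= zx _] st].
  have [tR tz] := IHle t z tw st; rewrite size_rcons ltnNge; apply/negP => pt.
  by have := nth_ge_find sR0 pt tR; rewrite leqNgt (leq_ltn_trans tz).
rewrite size_set_nth; split; first by lia.
have xE : nth 0 (set_nth 0 R0 p x) p = x by rewrite nth_set_nth /= eqxx.
rewrite -[X in _ <= X]xE.
by apply: nth_sorted_leq => //; rewrite size_set_nth; lia.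
Qed.

(** * Permutations as words *)

Definition perm_word n (w : 'S_n) : seq nat := [seq val (w i) | i <- enum 'I_n].

Lemma size_perm_word n (w : 'S_n) : size (perm_word w) = n.
Proof. by rewrite size_map size_enum_ord. Qed.

Lemma nth_perm_word n (w : 'S_n) (i : 'I_n) : nth 0 (perm_word w) i = w i.
Proof. by rewrite (nth_map i) ?size_enum_ord // nth_ord_enum. Qed.

Lemma perm_word_inj n : injective (@perm_word n).
Proof.
move=> w1 w2 eqw; apply/permP => i; apply: val_inj => /=.
by rewrite -!nth_perm_word eqw.
Qed.

Lemma perm_word_uniq n (w : 'S_n) : uniq (perm_word w).
Proof. by rewrite map_inj_uniq ?enum_uniq // => i j /val_inj/perm_inj. Qed.

Lemma perm_iota0 n (s : seq nat) :
  uniq s -> (forall i, i \in s -> i < n) -> size s = n -> perm_eq s (iota 0 n).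
Proof.
move=> us sn ss; apply: uniq_perm => //; first exact: iota_uniq.
have sub : {subset s <= iota 0 n} by move=> i /sn; rewrite mem_iota.
by apply: (uniq_min_size us sub _).2; rewrite size_iota ss.
Qed.

Lemma perm_word_iota n (w : 'S_n) : perm_eq (perm_word w) (iota 0 n).
Proof.
apply: perm_iota0; rewrite ?perm_word_uniq ?size_perm_word // => i.
by case/mapP => j _ ->; apply: ltn_ord.
Qed.

Lemma perm_words n :
  perm_eq [seq perm_word w | w <- enum {: 'S_n}] (permutations (iota 0 n)).
Proof.
have uw : uniq [seq perm_word w | w <- enum {: 'S_n}].
  by rewrite map_inj_uniq ?enum_uniq //; apply: perm_word_inj.
apply: uniq_perm => //; first exact: permutations_uniq.
have sub : {subset [seq perm_word w | w <- enum {: 'S_n}] <= permutations (iota 0 n)}.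
  by move=> s /mapP[w _ ->]; rewrite mem_permutations perm_word_iota.
apply: (uniq_min_size uw sub _).2.
by rewrite size_permutations ?iota_uniq // size_iota size_map -cardE card_Sn.
Qed.

Lemma enum_val_pairwise n (A : {pred 'I_n}) :
  pairwise (fun i j : 'I_n => i < j) (enum A).
Proof.
rewrite /enum_mem pairwise_filter // -[Finite.enum _](enumT 'I_n).
rewrite -(pairwise_map val ltn) val_enum_ord -(sorted_pairwise ltn_trans).
exact: iota_ltn_sorted.
Qed.

(** Increasing sets of positions correspond to increasing subsequences of the word, whose greatest
    length is read off the invariant at the last entry of the row. *)
Lemma lisE n (w : 'S_n) : lis w = size (insert_word (perm_word w)).1.1.
Proof.
case E : (insert_word _) => [[R u] T] /=.
have [exR leR] := insert_word_subseq (perm_word_uniq w) E.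
apply/eqP; rewrite eqn_leq; apply/andP; split.
  apply/bigmax_leqP => A /'forall_implyP incA.
  have tw : subseq [seq val (w i) | i <- enum A] (perm_word w).
    by apply: map_subseq; rewrite [X in subseq _ X]enumT; apply: filter_subseq.
  have st : sorted ltn [seq val (w i) | i <- enum A].
    rewrite (sorted_pairwise ltn_trans) pairwise_map.
    apply: (sub_in_pairwise (P := mem A) (r := fun i j : 'I_n => i < j)).
    - move=> i j iA jA ij; have /forallP/(_ j)/implyP/(_ jA)/implyP := incA i iA.
      exact.
    - by apply/allP => i; rewrite mem_enum.
    - exact: enum_val_pairwise.
  have <- : size [seq val (w i) | i <- enum A] = #|A| by rewrite size_map -cardE.
  case/lastP: [seq _ | _ <- _] tw st => [//|t x] tw st.
  by rewrite size_rcons; have [] := leR t x tw st.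
case Rn : (size R) => [//|m].
have [|t st /andP[/subseqP[msk _ tE]]] := exR m; first by rewrite Rn.
(* The mask selecting the subsequence, applied to the list of positions, yields the required set. *)
rewrite /perm_word -map_mask in tE; rewrite tE => sw.
set s := mask msk _ in tE sw.
have us : uniq s by apply: mask_uniq; apply: enum_uniq.
have ps : pairwise (fun i j : 'I_n => i < j) s.
  exact/pairwise_mask/enum_val_pairwise.
rewrite (sorted_pairwise ltn_trans) pairwise_map in sw.
apply: leq_trans (leq_bigmax_cond [set i in s] _); last first.
  apply/'forall_implyP => i; rewrite inE => si.
  apply/'forall_implyP => j; rewrite inE => sj; apply/implyP => ij.
  have [ji|ij'|ij'] := ltngtP (index j s) (index i s).
  - have /(pairwiseP i)/(_ _ _ _ _ ji) := ps.
    by rewrite !inE !index_mem !nth_index // ltnNge (ltnW ij) => /(_ sj si).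
  - have /(pairwiseP i)/(_ _ _ _ _ ij') := sw.
    by rewrite !inE !index_mem !nth_index // => /(_ si sj).
  - by have := congr1 (nth i s) ij'; rewrite !nth_index // => ji; rewrite ji ltnn in ij.
rewrite cardsE (card_uniqP us) -(size_map (fun i => val (w i))) -tE size_rcons st //.
Qed.

(** * The major index of the inverse, read off the word *)

(* For i = n - 1 the summand vanishes, as then [index n W = size W]. *)
Definition imaj n (W : seq nat) : nat :=
  \sum_(i < n) (index i.+1 W < index (i : nat) W) * i.+1.

Lemma index_perm_word n (w : 'S_n) (i : 'I_n) : index (val i) (perm_word w) = (w^-1)%g i.
Proof.
rewrite -{1}(permKV w i) (index_map (f := fun i => val (w i))) ?index_enum_ord //.
by move=> a b /val_inj/perm_inj.
Qed.

Lemma majV n (w : 'S_n) : maj (w^-1)%g = imaj n (perm_word w).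
Proof.
apply: eq_bigr => i _; rewrite index_perm_word.
have [ni|ni] := ltnP i.+1 n; last first.
  rewrite big_pred0 => [|j]; last by apply/negbTE; have := ltn_ord j; lia.
  rewrite memNindex ?size_perm_word; last first.
    by apply/mapP => -[j _ ij]; have := ltn_ord (w j); rewrite -[X in X < _]ij ltnNge ni.
  by rewrite ltnNge (ltnW (ltn_ord _)).
rewrite -[X in index X _]/(val (Ordinal ni)) index_perm_word big_mkcondr /=.
rewrite (big_pred1 (Ordinal ni)) //.
by case: (_ < _); rewrite ?mul1n.
Qed.

Lemma prefix_increasing n m (w : 'S_n) : m <= n ->
  [forall i : 'I_n, forall j : 'I_n, ((i < j) && (j < m)) ==> (w i < w j)]
  = sorted ltn (take m (perm_word w)).
Proof.
move=> mn; apply/forallP/idP => [inc|st i].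
  apply/(sortedP 0) => i; rewrite size_takel ?size_perm_word // => im.
  rewrite !nth_take //; last exact: ltnW.
  have i1n := leq_trans im mn; have i0n := ltnW i1n.
  have /forallP/(_ (Ordinal i1n))/implyP := inc (Ordinal i0n).
  by rewrite -!nth_perm_word /= ltnSn im => /(_ isT).
apply/forallP => j; apply/implyP => /andP[ij jm].
have := nth_sorted_ltn st ij.
by rewrite size_takel ?size_perm_word // !nth_take ?(ltn_trans ij) // !nth_perm_word; apply.
Qed.

Lemma index_filter (T : eqType) (p : pred T) (s : seq T) a b : p a -> p b ->
  (index a s < index b s) = (index a (filter p s) < index b (filter p s)).
Proof.
move=> pa pb; elim: s => [//|c s IHs] /=; case pc: (p c) => /=.
  by case: (c == a); case: (c == b) => //; apply: IHs.
by rewrite !ifN ?ltnS //; apply: contraFneq pc => ->.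
Qed.

(** A descent of the inverse at [v] only says that [v.+1] stands to the left of [v]. *)
Lemma eq_imaj n (W W' : seq nat) :
  (forall v, filter (pred2 v v.+1) W = filter (pred2 v v.+1) W') ->
  imaj n W = imaj n W'.
Proof.
move=> eqW; apply: eq_bigr => i _; congr (nat_of_bool _ * _).
have h s := @index_filter nat (pred2 (i : nat) i.+1) s i.+1 i.
by rewrite (h W) ?(h W') ?eqW //= ?eqxx ?orbT.
Qed.

Lemma imaj_pred n (W : seq nat) : perm_eq W (iota 0 n) ->
  imaj n W = \sum_(i < n.-1) (index i.+1 W < index (i : nat) W) * i.+1.
Proof.
case: n => [|n] pW; rewrite /imaj ?big_ord0 // big_ord_recr /= memNindex; last first.
  by rewrite (perm_mem pW) mem_iota ltnn.
by rewrite ltnNge index_size mul0n addn0.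
Qed.

(** * Insertion of a new maximum into the inverse *)

(* If [d] is the (0-based) descent set of a permutation of size [m], this is the
   descent set after insertion of a new maximum at position [y]. *)
Definition insert_descent (d : nat -> bool) (y i : nat) : bool :=
  if i < y then (i.+1 < y) && d i else (i == y) || d i.-1.

(** Appending [y] after raising the values [>= y] puts the maximum [m] at position [y] of the
    inverse: an ascent enters it, a descent leaves it, and later descents shift by one. *)
Lemma index_rcons_bump m (w : seq nat) y i : perm_eq w (iota 0 m) -> y <= m -> i < m ->
  let W := rcons (map (bump y) w) y in
  (index i.+1 W < index i W)
  = insert_descent (fun j => index j.+1 w < index j w) y i.
Proof.
move=> pw ym im W.
have memw j : (j \in w) = (j < m) by rewrite (perm_mem pw) mem_iota.
have sw : size w = m by rewrite (perm_size pw) size_iota.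
have injb : injective (bump y) := can_inj (bumpK y).
have yW : y \notin map (bump y) w.
  by apply/mapP => -[j _ /eqP]; rewrite (negPf (neq_bump _ _)).
have idx j : j < m -> index (bump y j) W = index j w.
  by move=> jm; rewrite /W -cats1 index_cat mem_map // memw jm index_map.
have idxy : index y W = m.
  by rewrite /W -cats1 index_cat (negPf yW) size_map sw /= eqxx addn0.
have idxm j : j < m -> index (bump y j) W < m.
  by move=> jm; rewrite idx // -[X in _ < X]sw index_mem memw.
rewrite /insert_descent; case: (ltnP i y) => iy.
  have iE : i = bump y i by rewrite /bump leqNgt iy.
  case: (ltnP i.+1 y) => i1y /=.
    have i1E : i.+1 = bump y i.+1 by rewrite /bump leqNgt i1y.
    by rewrite {1}i1E {2}iE !idx //; apply: leq_trans i1y ym.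
  have -> : i.+1 = y by apply/eqP; rewrite eqn_leq iy.
  by rewrite idxy iE ltnNge ltnW // idxm.
case: (eqVneq i y) => [->|iy'] /=.
  have -> : y.+1 = bump y y by rewrite /bump leqnn.
  by rewrite idxy idxm //; lia.
have i1E : i.+1 = bump y i by rewrite /bump iy.
have iE : i = bump y i.-1 by rewrite /bump; lia.
rewrite {1}i1E {2}iE !idx //; last by lia.
by rewrite prednK //; lia.
Qed.

Lemma perm_rcons_bump m (w : seq nat) y : perm_eq w (iota 0 m) -> y <= m ->
  perm_eq (rcons (map (bump y) w) y) (iota 0 m.+1).
Proof.
move=> pw ym; have memw j : (j \in w) = (j < m) by rewrite (perm_mem pw) mem_iota.
apply: (@perm_iota0 m.+1).
- rewrite rcons_uniq map_inj_uniq ?(perm_uniq pw) ?iota_uniq ?andbT; last exact/can_inj/bumpK.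
  by apply/mapP => -[j _ /eqP]; rewrite (negPf (neq_bump _ _)).
- move=> i; rewrite mem_rcons inE => /predU1P[-> //|/mapP[j + ->]].
  by rewrite memw /bump; lia.
- by rewrite size_rcons size_map (perm_size pw) size_iota.
Qed.

(** The last letter and the pattern of the others determine a word; injectivity and the count
    [(m + 1)! = m! (m + 1)] suffice. *)
Lemma perm_permutations_rcons m :
  perm_eq [seq rcons (map (bump y) w) y | w <- permutations (iota 0 m), y <- iota 0 m.+1]
    (permutations (iota 0 m.+1)).
Proof.
have uw : uniq [seq rcons (map (bump y) w) y | w <- permutations (iota 0 m), y <- iota 0 m.+1].
  apply: allpairs_uniq; rewrite ?permutations_uniq ?iota_uniq // => -[w y] [w' y'] _ _ /=.
  by case/rcons_inj => + yE; rewrite yE => wE; rewrite (inj_map (can_inj (bumpK y')) wE).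
apply: uniq_perm => //; first exact: permutations_uniq.
apply: (uniq_min_size uw _ _).2 => [s /allpairsP[[w y] [+ + ->]]|]; last first.
  by rewrite size_allpairs !size_permutations ?iota_uniq // !size_iota factS mulnC.
rewrite !mem_permutations mem_iota => /= pw ym.
exact: perm_rcons_bump.
Qed.

Import GRing.Theory.
Local Open Scope ring_scope.

(** Carlitz: the [m.+1] places for the maximum raise the major index by 0, ..., [m], each once. *)
Lemma sum_insert_descent (A : comNzRingType) (x : A) m (d : nat -> bool) :
  \sum_(y < m.+1) x ^+ (\sum_(i < m) insert_descent d y i * i.+1)%N
  = x ^+ (\sum_(i < m.-1) d i * i.+1)%N * \sum_(j < m.+1) x ^+ j.
Proof.
case: m => [|m]; first by rewrite !(big_ord_recl, big_ord0) /= !expr0 mul1r.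
elim: m => [|m IHm].
  by rewrite !(big_ord_recl, big_ord0) /= /insert_descent /= !addr0 !expr0 mul1r addrC.
(* Three kinds of places: at the end nothing is added ([top]); just before the last letter, a
   possible last descent is replaced by one of weight [m.+2] ([mid]); further left, that descent
   moves one step right ([low]). *)
have top k : (\sum_(i < k.+1) insert_descent d k.+1 i * i.+1 = \sum_(i < k) d i * i.+1)%N.
  rewrite big_ord_recr /= {2}/insert_descent ltnSn ltnn mul0n addn0.
  by apply: eq_bigr => i _; rewrite /insert_descent ltnS ltnW // ltnS ltn_ord.
have low (y : 'I_m.+1) : (\sum_(i < m.+2) insert_descent d y i * i.+1
    = \sum_(i < m.+1) insert_descent d y i * i.+1 + d m * m.+2)%N.
  rewrite big_ord_recr /=; congr (_ + _ * _)%N; rewrite /insert_descent.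
  have := ltn_ord y; rewrite ltnS => ym.
  by rewrite ltnNge (leq_trans ym) //= gtn_eqF.
have mid : (\sum_(i < m.+2) insert_descent d m.+1 i * i.+1
    = \sum_(i < m) d i * i.+1 + m.+2)%N.
  by rewrite big_ord_recr /= top /insert_descent ltnn eqxx mul1n.
move: IHm; rewrite [in X in X -> _]big_ord_recr /= top => IHm.
rewrite big_ord_recr big_ord_recr /= top mid.
under eq_bigr => y _ do rewrite low exprD.
rewrite -mulr_suml.
have -> : \sum_(y < m.+1) x ^+ (\sum_(i < m.+1) insert_descent d y i * i.+1)%N
  = x ^+ (\sum_(i < m) d i * i.+1)%N * \sum_(j < m.+2) x ^+ j
    - x ^+ (\sum_(i < m) d i * i.+1)%N by rewrite -IHm addrK.
have -> : (\sum_(i < m.+1) d i * i.+1 = \sum_(i < m) d i * i.+1 + d m * m.+1)%N.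
  exact: big_ord_recr.
set a := (\sum_(i < m) d i * i.+1)%N.
(* With a last descent the end place supplies the lowest power of the geometric sum; without one,
   [mid] supplies the highest. *)
case: (d m); rewrite ?mul1n ?mul0n ?addn0 ?expr0.
  rewrite [\sum_(j < m.+3) _]big_ord_recl expr0.
  under [in RHS]eq_bigr => j _ do rewrite lift0 exprS.
  rewrite -mulr_sumr !exprD !exprS.
  set S := \sum_(j < m.+2) _; ring.
rewrite [\sum_(j < m.+3) _]big_ord_recr /= !exprD.
set S := \sum_(j < m.+2) _; ring.
Qed.

(** The last [s] letters are stripped one by one, each giving one geometric factor; the word left is
    increasing, with major index 0. *)
Lemma sum_sorted_take (A : comNzRingType) (x : A) s n : (s <= n)%N ->
  \sum_(w <- permutations (iota 0 n) | sorted ltn (take (n - s) w)) x ^+ imaj n w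
  = \prod_(i < s) \sum_(j < n - i) x ^+ j.
Proof.
elim: s n => [|s IHs] n sn.
  rewrite big_ord0 big_mkcond (bigD1_seq (iota 0 n)) ?permutations_uniq //=; last first.
    by rewrite mem_permutations.
  rewrite subn0 take_oversize ?size_iota // iota_ltn_sorted big1_seq ?addr0.
    rewrite /imaj big1 ?expr0 // => i _.
    have idx j : (j <= n)%N -> index j (iota 0 n) = j.
      rewrite leq_eqVlt => /predU1P[->|jn].
        by rewrite memNindex ?size_iota // mem_iota ltnn.
      by rewrite -{1}[j](nth_iota 0 0 jn) index_uniq ?size_iota ?iota_uniq.
    by rewrite (idx i.+1 (ltn_ord i)) (idx i (ltnW (ltn_ord i))) ltnNge leqnSn.
  move=> w /andP[/negPf wi]; rewrite mem_permutations => pw.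
  rewrite take_oversize; last by rewrite (perm_size pw) size_iota.
  case: ifP => // sw; case/eqP: wi.
  by apply: (irr_sorted_eq ltn_trans ltnn sw (iota_ltn_sorted 0 n)); apply: perm_mem.
case: n sn => [//|n]; rewrite ltnS => sn.
rewrite big_mkcond -(perm_big _ (perm_permutations_rcons n)) big_allpairs_dep /=.
rewrite big_ord_recl subn0 subSS.
under [X in _ = _ * X]eq_bigr => i _ do rewrite lift0 subSS.
rewrite -IHs // mulr_sumr [in RHS]big_mkcond /=.
apply: eq_big_seq => w; rewrite mem_permutations => pw.
have sw : size w = n by rewrite (perm_size pw) size_iota.
(* [bump y] is increasing and the appended letter lies outside the prefix. *)
have sE y : sorted ltn (take (n - s) (rcons (map (bump y) w) y))
  = sorted ltn (take (n - s) w).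
  rewrite -cats1 takel_cat ?size_map ?sw ?leq_subr // -map_take sorted_map.
  by apply: eq_sorted => i j /=; rewrite !ltnNge leq_bump2.
under eq_big_seq => y _ do rewrite sE.
case: ifP => _; last by rewrite big1_seq.
rewrite (imaj_pred pw) mulrC.
rewrite -(sum_insert_descent x n (fun i => index i.+1 w < index i w)%N).
rewrite -[0%N :: _]/(index_iota 0 n.+1) big_mkord.
apply: eq_bigr => y _; have ym : (y <= n)%N by rewrite -ltnS.
rewrite (imaj_pred (perm_rcons_bump pw ym)) /=; congr (x ^+ _).
by apply: eq_bigr => i _; rewrite (index_rcons_bump pw ym (ltn_ord i)).
Qed.

(** * Bit strings and binomial inversion *)

Fixpoint bitseqs (s : nat) : seq bitseq :=
  if s is s'.+1 then map (cons true) (bitseqs s') ++ map (cons false) (bitseqs s')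
  else [:: [::]].

Lemma mem_bitseqs s (T : bitseq) : (T \in bitseqs s) = (size T == s).
Proof.
elim: s T => [|s IHs] [|b T] //=.
  by rewrite mem_cat; apply/norP; split; apply/mapP => -[].
have consI c : injective (cons c : bitseq -> bitseq) by move=> U V [].
have consF c : c != b -> ((b :: T) \in map (cons c) (bitseqs s)) = false.
  by move=> cb; apply/mapP => -[U _ [bc _]]; rewrite bc eqxx in cb.
rewrite mem_cat eqSS -IHs.
by case: b consF => consF; [rewrite (consF false) // orbF | rewrite (consF true)]; rewrite ?mem_map.
Qed.

Lemma bitseqs_uniq s : uniq (bitseqs s).
Proof.
elim: s => [//|s IHs] /=; rewrite cat_uniq.
rewrite !map_inj_uniq ?IHs ?andbT //=; try by move=> U V [].
by apply/hasPn => _ /mapP[U _ ->]; apply/mapP => -[].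
Qed.

(** Expanding the product chooses ['X] or [1] in each factor; sums over bit strings stand for sums
    with binomial coefficients. *)
Lemma exprD1_bitseqs (A : comNzRingType) s :
  ('X + 1 : {poly A}) ^+ s = \sum_(T <- bitseqs s) 'X^(count id T).
Proof.
elim: s => [|s IHs]; first by rewrite big_seq1.
rewrite exprSr IHs /= big_cat !big_map /= mulrDr mulr1 mulr_suml; congr (_ + _).
by apply: eq_bigr => T _; rewrite -exprSr add1n.
Qed.

(* Apply the linear form X^a |-> Y a to X^k = ((X + 1) - 1)^k. *)
Lemma binomial_inversion (A : comNzRingType) (Y : nat -> A) k :
  Y k = \sum_(r < k.+1)
    (-1) ^+ (k - r) * 'C(k, r)%:R * \sum_(T <- bitseqs r) Y (count id T).
Proof.
(* Truncation at degree [k] is harmless: only powers up to ['X^k] are evaluated. *)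
pose L (p : {poly A}) := \sum_(a < k.+1) p`_a * Y a.
have L_sum I (s : seq I) (F : I -> {poly A}) : L (\sum_(i <- s) F i) = \sum_(i <- s) L (F i).
  rewrite exchange_big; apply: eq_bigr => a _.
  by rewrite coef_sum mulr_suml.
have LXn c : (c <= k)%N -> L 'X^c = Y c.
  move=> ck; have ck' : (c < k.+1)%N by [].
  rewrite /L (bigD1 (Ordinal ck')) //= coefXn eqxx mul1r big1 ?addr0 // => a ac.
  rewrite coefXn; suff -> : (a == c :> nat) = false by rewrite mul0r.
  by apply: contraNF ac => /eqP e; apply/eqP/val_inj.
rewrite -(LXn k) // -['X in LHS](addKr 1) addrC [1 + 'X]addrC addrC exprDn L_sum.
apply: eq_bigr => r _.
transitivity ((-1) ^+ (k - r) * 'C(k, r)%:R * L (('X + 1) ^+ r)).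
  rewrite /L mulr_sumr; apply: eq_bigr => a _; rewrite mulrA; congr (_ * _).
  have -> : (-1) ^+ (k - r) = ((-1) ^+ (k - r))%:P :> {poly A}.
    by rewrite polyC_exp polyCN.
  by rewrite coefMn coefCM mulrAC mulr_natr.
congr (_ * _); rewrite exprD1_bitseqs L_sum; apply: eq_big_seq => T.
rewrite mem_bitseqs => /eqP sT; apply: LXn; apply: leq_trans (count_size _ _) _.
by rewrite sT -ltnS.
Qed.

(** * Classes of words with prescribed bits *)

Definition bit_class n (T : bitseq) : seq (seq nat) :=
  [seq w <- permutations (iota 0 n) | (insert_word w).2 == T ++ nseq (n - size T) false].

(** The right side sees [T] only through [count id T]. The bound on [size T] leaves at least
    [size u] initial bits false. *)
Lemma mem_bit_class n (T : bitseq) (R u : seq nat) : (2 * size T <= n)%N ->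
  ((R, u) \in [seq (insert_word w).1 | w <- bit_class n T])
  = [&& sorted ltn R, perm_eq (R ++ u) (iota 0 n), size u == count id T
      & all_unbump u R].
Proof.
move=> Tn.
have unbumpE : perm_eq (R ++ u) (iota 0 n) -> size u = count id T ->
    all_extractible (T ++ nseq (n - size T) false) R u = all_unbump u R.
  move=> pRu uT; have Run : (size R + size u = n)%N.
    by rewrite -size_cat (perm_size pRu) size_iota.
  have uT' : (size u <= size T)%N by rewrite uT count_size.
  by apply: all_extractible_unbump => //; lia.
apply/mapP/and4P => [[w]|[sR pRu /eqP uT ok]].
  rewrite mem_filter mem_permutations => /andP[/eqP wT pw].
  case E : (insert_word w) wT => [[R' u'] T'] /= TE [RE uE]; subst.
  have uw : uniq w by rewrite (perm_uniq pw) iota_uniq.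
  have [sR pR ok _] := insert_wordK uw E.
  have [_ uT] := size_bumped E.
  have {}uT : size u' = count id T by rewrite uT count_cat count_nseq mul0n addn0.
  have {}pR := perm_trans pR pw.
  by split; rewrite ?uT // -unbumpE.
have uRu : uniq (R ++ u) by rewrite (perm_uniq pRu) iota_uniq.
rewrite -unbumpE // in ok; have [pw wE] := extract_wordK sR uRu ok.
exists (extract_word (T ++ nseq (n - size T) false) R u); last by rewrite wE.
by rewrite mem_filter mem_permutations wE eqxx (perm_trans pw).
Qed.

Lemma bit_class_inj n (T : bitseq) :
  {in bit_class n T &, injective (fun w => (insert_word w).1)}.
Proof.
move=> w w'; rewrite !mem_filter !mem_permutations.
move=> /andP[/eqP wT pw] /andP[/eqP w'T pw'].
have uw : uniq w by rewrite (perm_uniq pw) iota_uniq.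
have uw' : uniq w' by rewrite (perm_uniq pw') iota_uniq.
case E : (insert_word w) wT => [[R u] U] /= UE.
case E' : (insert_word w') w'T => [[R' u'] U'] /= UE' [RR uu]; subst.
by have [_ _ _ <-] := insert_wordK uw E; have [_ _ _ <-] := insert_wordK uw' E'.
Qed.

(** The statistic is a function of [(R, u)], and both classes map bijectively onto the same set of
    such pairs. *)
Lemma sum_bit_class (A : comNzRingType) (x : A) n (T : bitseq) : (2 * size T <= n)%N ->
  \sum_(w <- bit_class n T) x ^+ imaj n w
  = \sum_(w <- bit_class n (nseq (count id T) true)) x ^+ imaj n w.
Proof.
move=> Tn.
have stat S : \sum_(w <- bit_class n S) x ^+ imaj n w
    = \sum_(st <- [seq (insert_word w).1 | w <- bit_class n S])
        x ^+ imaj n (rev st.2 ++ st.1).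
  rewrite big_map; apply: eq_big_seq => w; rewrite mem_filter mem_permutations.
  move=> /andP[_ pw]; congr (x ^+ _); apply: eq_imaj => v.
  have uw : uniq w by rewrite (perm_uniq pw) iota_uniq.
  case E : (insert_word w) => [[R u] U] /=.
  exact: filter_insert_word uw E.
rewrite !stat; apply: perm_big; apply: uniq_perm.
- rewrite map_inj_in_uniq ?filter_uniq ?permutations_uniq //; exact: bit_class_inj.
- rewrite map_inj_in_uniq ?filter_uniq ?permutations_uniq //; exact: bit_class_inj.
move=> [R u]; rewrite !mem_bit_class ?count_nseq ?mul1n // size_nseq.
by apply: leq_trans Tn; rewrite leq_mul2l count_size.
Qed.

(** Words whose first [n - s] letters increase are sorted by their last [s] bits. *)
Lemma prod_bit_classes (A : comNzRingType) (x : A) n s : (2 * s <= n)%N ->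
  \prod_(i < s) \sum_(j < n - i) x ^+ j
  = \sum_(T <- bitseqs s) \sum_(w <- bit_class n (nseq (count id T) true)) x ^+ imaj n w.
Proof.
move=> sn; have sn' : (s <= n)%N by lia.
rewrite -sum_sorted_take //.
transitivity (\sum_(T <- bitseqs s) \sum_(w <- permutations (iota 0 n))
    if (insert_word w).2 == T ++ nseq (n - s) false then x ^+ imaj n w else 0).
  rewrite exchange_big big_mkcond /=; apply: eq_big_seq => w.
  rewrite mem_permutations => pw.
  have uw : uniq w by rewrite (perm_uniq pw) iota_uniq.
  have sw : size w = n by rewrite (perm_size pw) size_iota.
  have sT : size (insert_word w).2 = n.
    by case E : (insert_word w) => [[R u] U]; have [] := size_bumped E; rewrite sw.
  rewrite -insert_bits_take ?sw ?leq_subr // subKn //.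
  set U := (insert_word w).2 in sT *.
  (* Each word matches exactly one string, [take s U]. *)
  have UE T : T \in bitseqs s -> (U == T ++ nseq (n - s) false)
      = (T == take s U) && (drop s U == nseq (n - s) false).
    rewrite mem_bitseqs => /eqP sT'; rewrite -{1}(cat_take_drop s U) eqseq_cat.
      by rewrite [T == _]eq_sym.
    by rewrite size_takel ?sT // sT.
  rewrite (eq_big_seq (fun T => if (T == take s U) && (drop s U == nseq (n - s) false)
    then x ^+ imaj n w else 0)) => [|T /UE-> //].
  case: ifP => _; last by rewrite big1 // => T _; rewrite andbF.
  rewrite (bigD1_seq (take s U)) ?bitseqs_uniq ?mem_bitseqs ?size_takel ?sT //=.
  by rewrite eqxx big1 ?addr0 // => T /negPf->.
apply: eq_big_seq => T; rewrite mem_bitseqs => /eqP sT.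
by rewrite -sum_bit_class ?sT // big_filter -big_mkcond sT.
Qed.

(** * The permutations of the theorem as one class, and the conclusion *)

(** The row has length [n] minus the number of bumps; if the first [n - k] letters bump nothing,
    length [n - k] forces all the others to bump. *)
Lemma mem_PiSet n k (w : 'S_n) : (k <= n)%N ->
  (w \in PiSet n k) = ((insert_word (perm_word w)).2 == nseq k true ++ nseq (n - k) false).
Proof.
move=> kn; rewrite inE prefix_increasing ?leq_subr // lisE.
have uw := perm_word_uniq w; have sw := size_perm_word w.
rewrite -insert_bits_take ?sw ?leq_subr // subKn //.
case E : (insert_word _) => [[R u] U] /=.
have [_ pR _ _] := insert_wordK uw E; have [sU uU] := size_bumped E.
have {}uU : (size R + count id U = n)%N by rewrite -uU -size_cat (perm_size pR).
rewrite sw in sU.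
rewrite -{2}(cat_take_drop k U) eqseq_cat ?size_nseq ?size_takel ?sU //.
case: (drop k U =P _) => [dU|_]; rewrite ?andbF ?andbT //.
have sk : size (take k U) = k by rewrite size_takel ?sU.
have cU : count id U = count id (take k U).
  by rewrite -{1}(cat_take_drop k U) dU count_cat count_nseq mul0n addn0.
have -> : (take k U == nseq k true) = all id (take k U).
  rewrite -{2}sk; apply/eqP/idP => [->|]; first by rewrite all_nseq orbT.
  by move=> aU; apply/all_pred1P; rewrite (eq_all (a2 := id)) // => -[].
by rewrite all_count sk -cU; lia.
Qed.

Lemma sum_PiSet (A : comNzRingType) (x : A) n k : (k <= n)%N ->
  \sum_(w in PiSet n k) x ^+ maj (w^-1)%g
  = \sum_(w <- bit_class n (nseq k true)) x ^+ imaj n w.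
Proof.
move=> kn; rewrite big_filter size_nseq -(perm_big _ (perm_words n)) big_map big_enum_cond.
by apply: eq_big => [w|w _]; rewrite ?mem_PiSet // majV.
Qed.

Lemma qintE m : qint m = \sum_(j < m) q ^+ j.
Proof.
(* The polynomials 1 and ['X] have different sizes. *)
have q1 : 1 - q != 0.
  rewrite subr_eq0 -[1]/(tofrac (1 : {poly int})) tofrac_eq; apply/eqP.
  move/(congr1 (fun p : {poly int} => size p)).
  by rewrite /= size_poly1 size_polyX.
by rewrite /qint -opprB subrX1 -mulNr opprB mulrAC mulfV // mul1r.
Qed.

Theorem theorem2 (n k : nat) (hnk : (2 * k <= n)%N) :
  \sum_(w in PiSet n k) q ^+ maj (w^-1)%g
  = \sum_(r < k.+1)
      (-1) ^+ (k - r) * 'C(k, r)%:R * \prod_(i < r) qint (n - i).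
Proof.
rewrite sum_PiSet; last by lia.
rewrite (binomial_inversion (fun a => \sum_(w <- bit_class n (nseq a true)) q ^+ imaj n w)).
apply: eq_bigr => r _; have rk := ltn_ord r; congr (_ * _).
(* From [r <= k] and [hnk], the bound [2 * r <= n] holds for every summand. *)
rewrite -prod_bit_classes; last by lia.
by apply: eq_bigr => i _; rewrite qintE.
Qed.
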